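(* Let $G'\subset\Omega$ be a domain. A scalar function $F\in C^1(G')$ is a first integral on $G'$ of the Pfaff system of equations $$\omega_j(x)=0,\qquad j=1,\ldots,m,$$ with $\omega_j\in C(G)$, $j=1,\ldots,m$, if and only if $F$ is a first integral on $G'$ of the system of total differential equations $$dx_j=\sum_{\nu=m+1}^n\widehat a_{j\nu}(x)\,dx_\nu,\qquad j=1,\ldots,m,$$ obtained by solving the Pfaff system for $dx_1,\ldots,dx_m$.
   Context: A domain is an open arcwise connected set. $G\subset\mathbb R^n$ is a domain, $m\le n$, and $\omega_j(x)=\sum_{i=1}^n w_{ji}(x)\,dx_i$, $j=1,\ldots,m$, are linear differential forms on $G$ with continuous coefficients. $\Omega\subset G$ is a domain whose complement in $G$ has measure zero and on which the $m\times m$ matrix $\widehat w(x)=\|w_{ji}(x)\|_{1\le j,i\le m}$ (the first $m$ columns of the coefficient matrix) is nonsingular. The coefficients $\widehat a_{j\nu}$ on $\Omega$ are the entries of $-\widehat w(x)^{-1}\|w_{j\nu}(x)\|_{1\le j\le m,\ m<\nu\le n}$. A first integral of the Pfaff system on $G'$ is a function $F\in C^1(G')$ for which there exist $a_j\in C(G')$, $j=1,\ldots,m$, with $dF(x)=\sum_{j=1}^m a_j(x)\,\omega_j(x)$ for all $x\in G'$. A first integral on $G'$ of the total differential system (independent variables $x_{m+1},\ldots,x_n$, dependent variables $x_1,\ldots,x_m$) is a function $F\in C^1(G')$ whose differential by virtue of the system vanishes on $G'$, i.e. $\partial_{x_\nu}F(x)+\sum_{j=1}^m\widehat a_{j\nu}(x)\,\partial_{x_j}F(x)=0$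 for all $x\in G'$, $\nu=m+1,\ldots,n$. *)

(* Defs.v *)
From mathcomp Require Import all_boot all_order all_algebra.
From mathcomp Require Import all_classical all_reals all_analysis.
Export numFieldNormedType.Exports.

Set Implicit Arguments.
Unset Strict Implicit.
Unset Printing Implicit Defensive.

Import Order.TTheory GRing.Theory Num.Theory.

Local Open Scope classical_set_scope.
Local Open Scope ring_scope.

Definition arcwise_connected (R : realType) (n : nat) (A : set 'rV[R]_n) : Prop :=
  forall x y, A x -> A y ->
    exists gamma : R -> 'rV[R]_n,
      [/\ {within `[0, 1], continuous gamma}, gamma 0 = x, gamma 1 = y &
          forall t, t \in `[0, 1] -> A (gamma t)].

Definition domain (R : realType) (n : nat) (A : set 'rV[R]_n) : Prop :=
  open A /\ arcwise_connected A.

(* n-dimensional Lebesgue measure zero: the library has no Lebesgue measure on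
   'rV[R]_n, so this says that the outer measure vanishes, i.e. A has countable
   covers by closed boxes of arbitrarily small total volume (0 < n is meant). *)
Definition measure_zero (R : realType) (n : nat) (A : set 'rV[R]_n) : Prop :=
  forall eps : R, 0 < eps ->
    exists a b : nat -> 'rV[R]_n,
      [/\ forall k i, a k 0 i <= b k 0 i,
          A `<=` \bigcup_k [set x | forall i, a k 0 i <= x 0 i <= b k 0 i] &
          (\sum_(0 <= k <oo) (\prod_(i < n) (b k 0 i - a k 0 i))%:E
             <= eps%:E)%E].

Definition partial (R : realType) (n : nat) (i : 'I_n) (F : 'rV[R]_n -> R)
    (x : 'rV[R]_n) : R :=
  'D_(delta_mx 0 i) F x.

(* Functions on a set are represented by total functions of which only the
   values on that set matter; A is open wherever the next predicates are used. *)
Definition C0 (R : realType) (n : nat) (A : set 'rV[R]_n)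
    (f : 'rV[R]_n -> R) : Prop :=
  {within A, continuous f}.

Definition C1 (R : realType) (n : nat) (A : set 'rV[R]_n)
    (F : 'rV[R]_n -> R) : Prop :=
  (forall x, A x -> differentiable F x) /\ (forall i, C0 A (partial i F)).

(* A family of m linear differential forms is given by its coefficient matrix w;
   this is the value at x of the j-th form, as a function of the increment dx. *)
Definition diff_form (R : realType) (m n : nat) (w : 'rV[R]_n -> 'M[R]_(m, n))
    (j : 'I_m) (x : 'rV[R]_n) (dx : 'rV[R]_n) : R :=
  \sum_(i < n) w x j i * dx 0 i.

Definition pfaff_first_integral (R : realType) (m n : nat)
    (w : 'rV[R]_n -> 'M[R]_(m, n)) (A : set 'rV[R]_n)
    (F : 'rV[R]_n -> R) : Prop :=
  C1 A F /\
  exists a : 'I_m -> 'rV[R]_n -> R,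
    (forall j, C0 A (a j)) /\
    forall x, A x -> forall dx : 'rV[R]_n,
      'd F x dx = \sum_(j < m) a j x * diff_form w j x dx.

(* In dimension m + k, the indices lshift k j are those of the dependent
   variables and the indices rshift m nu those of the independent ones. *)
Definition total_first_integral (R : realType) (m k : nat)
    (a : 'rV[R]_(m + k) -> 'M[R]_(m, k)) (A : set 'rV[R]_(m + k))
    (F : 'rV[R]_(m + k) -> R) : Prop :=
  C1 A F /\
  forall x, A x -> forall nu : 'I_k,
    partial (rshift m nu) F x
      + \sum_(j < m) a x j nu * partial (lshift k j) F x = 0.

Definition w_hat (R : realType) (m k : nat)
    (w : 'rV[R]_(m + k) -> 'M[R]_(m, m + k)) (x : 'rV[R]_(m + k)) : 'M[R]_m :=
  lsubmx (w x).

Definition a_hat (R : realType) (m k : nat)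
    (w : 'rV[R]_(m + k) -> 'M[R]_(m, m + k)) (x : 'rV[R]_(m + k)) :
    'M[R]_(m, k) :=
  - (invmx (w_hat w x) *m rsubmx (w x)).

(* Main.v *)
(* Split the gradient of F as (g1, g2) and the coefficient matrix as (W1, W2)
   after the first m columns, so that a_hat = - W1^-1 W2. The Pfaff condition
   (g1, g2) = a (W1, W2) forces a = g1 W1^-1, and then says g2 = g1 W1^-1 W2,
   which is the condition of the total system. This a is continuous on G'
   because, by Cramer's rule, W1^-1 is. *)
Require Import Defs.
From mathcomp Require Import all_boot all_order all_algebra.
From mathcomp Require Import all_classical all_reals all_analysis.

Local Open Scope classical_set_scope.
Local Open Scope ring_scope.

Import Order.TTheory GRing.Theory Num.Theory.

(** The Leibniz formula is a finite sum of finite products of entries. The filter is arbitrary so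
    that the limit can later be taken along neighbourhoods within [G']. *)
Lemma cvg_det (K : numFieldType) (T : Type) (F : set_system T) {FF : Filter F}
    (n : nat) (A : T -> 'M[K]_n) (B : 'M[K]_n) :
  (forall i j, A t i j @[t --> F] --> B i j) ->
  \det (A t) @[t --> F] --> \det B.
Proof.
move=> AB; rewrite /determinant.
apply: cvg_big => [|s _]; first exact: add_continuous.
apply: cvgM; first exact: cvg_cst.
by apply: cvg_big => [|i _]; [exact: mul_continuous | exact: AB].
Qed.

Lemma cvg_adjugate (K : numFieldType) (T : Type) (F : set_system T)
    {FF : Filter F} (n : nat) (A : T -> 'M[K]_n) (B : 'M[K]_n) :
  (forall i j, A t i j @[t --> F] --> B i j) ->
  forall i j, (\adj (A t)) i j @[t --> F] --> (\adj B) i j.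
Proof.
move=> AB i j; under eq_fun do rewrite mxE /cofactor; rewrite mxE /cofactor.
apply: cvgM; first exact: cvg_cst.
apply: cvg_det => a b; under eq_fun do rewrite !mxE; rewrite !mxE.
exact: AB.
Qed.

(** Cramer's rule: the inverse is the adjugate divided by the determinant, and both of these
    converge. *)
Lemma cvg_invmx (K : numFieldType) (T : Type) (F : set_system T)
    {FF : Filter F} (n : nat) (A : T -> 'M[K]_n) (B : 'M[K]_n) :
  B \in unitmx -> (forall i j, A t i j @[t --> F] --> B i j) ->
  forall i j, (invmx (A t)) i j @[t --> F] --> (invmx B) i j.
Proof.
move=> Bu AB i j; have detB0 : \det B != 0 by rewrite -unitfE -unitmxE.
have cdet : \det (A t) @[t --> F] --> \det B by exact: cvg_det.
rewrite [in X in _ --> X]/invmx Bu mxE.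
have cvg_formula : (\det (A t))^-1 * (\adj (A t)) i j @[t --> F] -->
    (\det B)^-1 * (\adj B) i j.
  by apply: cvgM; [exact: cvgV | exact: cvg_adjugate].
(* On a singular matrix [invmx] returns the matrix itself, so Cramer's formula is only claimed
   eventually, where [\det (A t)] stays away from 0 along with its limit. *)
apply: cvg_trans cvg_formula; apply: near_eq_cvg.
apply: filterS (cvgr_neq0 _ cdet detB0) => t detA0.
by rewrite /invmx unitmxE unitfE detA0 [RHS]mxE.
Qed.

Definition gradient {R : realType} {n : nat} (F : 'rV[R]_n -> R)
  (x : 'rV[R]_n) : 'rV[R]_n := \row_i partial i F x.

Lemma diff_gradient (R : realType) (n : nat) (F : 'rV[R]_n -> R)
    (x dx : 'rV[R]_n) :
  differentiable F x -> 'd F x dx = (gradient F x *m dx^T) 0 0.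
Proof.
move=> dF; rewrite [in LHS](row_sum_delta dx) linear_sum mxE.
by apply: eq_bigr => i _; rewrite linearZ /= !mxE /partial deriveE // mulrC.
Qed.

(** Together with [diff_gradient], this turns the Pfaff condition into an identity between row
    vectors tested against every increment. *)
Lemma sum_diff_form (R : realType) (m n : nat)
    (w : 'rV[R]_n -> 'M[R]_(m, n)) (a : 'rV[R]_m) (x dx : 'rV[R]_n) :
  \sum_(j < m) a 0 j * diff_form w j x dx = (a *m w x *m dx^T) 0 0.
Proof.
rewrite -mulmxA mxE; apply: eq_bigr => j _; rewrite mxE /diff_form.
by congr (_ * _); apply: eq_bigr => i _; rewrite mxE.
Qed.

Lemma row_dot_inj (R : pzRingType) (n : nat) (u v : 'rV[R]_n) :
  (forall d : 'rV[R]_n, (u *m d^T) 0 0 = (v *m d^T) 0 0) -> u = v.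
Proof.
move=> uv; apply/rowP => i; have := uv (delta_mx 0 i).
by rewrite trmx_delta -!colE !mxE.
Qed.

(** The left side of the equation for [nu] is the [nu]-th entry of g2 - g1 W1^-1 W2, by unfolding
    [a_hat] and commuting the scalar factors. *)
Lemma gradient_a_hat (R : realType) (m k : nat)
    (w : 'rV[R]_(m + k) -> 'M[R]_(m, m + k)) (F : 'rV[R]_(m + k) -> R)
    (x : 'rV[R]_(m + k)) :
  (forall nu : 'I_k, partial (rshift m nu) F x
      + \sum_(j < m) a_hat w x j nu * partial (lshift k j) F x = 0) <->
  rsubmx (gradient F x) =
    lsubmx (gradient F x) *m invmx (w_hat w x) *m rsubmx (w x).
Proof.
have E nu : partial (rshift m nu) F x
      + \sum_(j < m) a_hat w x j nu * partial (lshift k j) F x =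
    (rsubmx (gradient F x) - lsubmx (gradient F x) *m invmx (w_hat w x)
       *m rsubmx (w x)) 0 nu.
  rewrite -mulmxA -mulmxN -/(a_hat w x) 3!mxE; congr (_ + _).
  rewrite mxE; apply: eq_bigr => j _.
  by rewrite [lsubmx _ _ _]mxE [gradient _ _ _ _]mxE mulrC.
split=> [h|h nu]; last by rewrite E h subrr mxE.
by apply/eqP; rewrite -subr_eq0; apply/eqP/rowP => nu; rewrite -E h mxE.
Qed.

Theorem theorem4p15 (R : realType) (m k : nat) (m_gt0 : (0 < m)%N)
    (G : set 'rV[R]_(m + k)) (hG : domain G)
    (w : 'rV[R]_(m + k) -> 'M[R]_(m, m + k))
    (hw : forall j i, C0 G (fun x => w x j i))
    (Omega : set 'rV[R]_(m + k)) (hOmega : domain Omega)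
    (sOmega : Omega `<=` G) (nullOmega : measure_zero (G `\` Omega))
    (unitOmega : forall x, Omega x -> w_hat w x \in unitmx)
    (G' : set 'rV[R]_(m + k)) (hG' : domain G') (sG' : G' `<=` Omega)
    (F : 'rV[R]_(m + k) -> R) (hF : C1 G' F) :
  pfaff_first_integral w G' F <-> total_first_integral (a_hat w) G' F.
Proof.
have [dF cF] := hF.
have wu x : G' x -> w_hat w x \in unitmx by move=> /sG' /unitOmega.
have wc i j : C0 G' (fun x => w x i j).
  exact: continuous_subspaceW (subset_trans sG' sOmega) (hw i j).
split=> -[_ H]; split=> //.
  have [a [_ aw]] := H => x G'x; apply/gradient_a_hat.
  have {aw}gE : gradient F x = \row_j a j x *m w x.
    apply: row_dot_inj => dx; rewrite -diff_gradient; last exact: dF.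
    rewrite -sum_diff_form aw //; apply: eq_bigr => j _.
    by rewrite mxE.
  (* The first m columns give g1 = a W1, so g1 W1^-1 collapses to a; the remaining columns then give
     g2 = a W2. *)
  have -> : lsubmx (gradient F x) = \row_j a j x *m w_hat w x.
    by rewrite gE /w_hat mulmx_lsub.
  by rewrite mulmxK ?wu // mulmx_rsub gE.
exists (fun j x => (lsubmx (gradient F x) *m invmx (w_hat w x)) 0 j).
split=> [j|x G'x dx].
  (* Continuity is checked only at points of [G'], where [w_hat w x] is invertible. *)
  rewrite /C0 continuous_subspace_in => x /[1!inE] G'x.
  rewrite /continuous_at /from_subspace.
  under eq_fun do rewrite mxE; rewrite mxE.
  apply: cvg_big => [|i _]; first exact: add_continuous.
  apply: cvgM.
    by under eq_fun do rewrite !mxE; rewrite !mxE; exact: cF.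
  apply: cvg_invmx; first exact: wu.
  move=> a b; under eq_fun do rewrite !mxE; rewrite !mxE.
  exact: wc.
rewrite sum_diff_form diff_gradient; last exact: dF.
(* Compare column blocks: the first is g1 = g1 W1^-1 W1, the second is the total system. *)
congr ((_ *m _) 0 0); rewrite -[LHS]hsubmxK -[w x in RHS]hsubmxK mul_mx_row.
have /gradient_a_hat -> := H x G'x.
by rewrite mulmxKV // wu.
Qed.
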